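(* Let $a$ be a binary sequence of even length $n=2m$ and let $1\leq k<m$. Put $\delta_j=a_ja_{n+1-j}$ for $1\le j\le n$. (i) If $k$ is even, then $$C_{k}=\sum_{j=1}^{m-k}a_{j}a_{j+k}(1+\delta_{j}\delta_{j+k})+\sum_{j=1}^{\frac{k}{2}}a_{j+m-k}a_{m+1-j}(\delta_{j+m-k}+\delta_{m+1-j}).$$ (ii) If $k$ is odd, then $$C_{k}=\delta_{\frac{n-k+1}{2}}+\sum_{j=1}^{m-k}a_{j}a_{j+k}(1+\delta_{j}\delta_{j+k})+\sum_{j=1}^{\frac{k-1}{2}}a_{j+m-k}a_{m+1-j}(\delta_{j+m-k}+\delta_{m+1-j}).$$
   Context: For an integer $n>1$, a binary sequence of length $n$ is an element $a=(a_1,\dots,a_n)$ of $\{-1,1\}^n$. For $k=0,1,\dots,n-1$ its $k$th aperiodic autocorrelation is $C_k=C_k(a)=\sum_{j=1}^{n-k}a_ja_{j+k}$. Empty sums are $0$. *)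

(* Defs.v *)
From mathcomp Require Import all_boot all_order all_algebra.

Set Implicit Arguments.
Unset Strict Implicit.
Unset Printing Implicit Defensive.

Import GRing.Theory Num.Theory.
Local Open Scope ring_scope.

Definition binary_seq (n : nat) (a : n.-tuple int) : Prop :=
  forall i : 'I_n, tnth a i = -1 \/ tnth a i = 1.

(* Tuples are numbered from 0, the mathematical indices from 1.
   The value is only meaningful for 1 <= j <= n. *)
Definition term (n : nat) (a : n.-tuple int) (j : nat) : int :=
  nth 0 a j.-1.

(* Meant for 0 <= k <= n - 1. *)
Definition autocorr (n : nat) (a : n.-tuple int) (k : nat) : int :=
  \sum_(1 <= j < (n - k).+1) term a j * term a (j + k)%N.

Definition delta (n : nat) (a : n.-tuple int) (j : nat) : int :=
  term a j * term a (n + 1 - j)%N.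

(* Main.v *)
Require Import Defs.
From mathcomp Require Import all_boot all_order all_algebra.
From mathcomp Require Import zify ring.
Import GRing.Theory.

Local Open Scope ring_scope.

(** Reversing the sequence sends the pair of positions [(j, j + k)] to
    [(n + 1 - j - k, n + 1 - j)], so it acts on the summands
    [a_j a_(j+k)] of [C_k] through the reflection [j |-> n - k + 1 - j] of the
    index range [1 .. n - k].  The identity is obtained by adding each summand
    to its mirror image ([sum_nat_fold]).

    Because the entries square to 1, an entry [a_p] equals
    [delta_p a_(n+1-p)], and this gives two forms for such a pair.  Rewriting
    both factors of the mirror image alone gives
    [a_j a_(j+k) (1 + delta_j delta_(j+k))] ([mirror_pair_shift]).  Naming the
    mirror index [q = n - k + 1 - j], for which [j + k = n + 1 - q], and
    rewriting one factor of each summand gives [a_j a_q (delta_j + delta_q)]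
    ([mirror_pair_reflect]).  The first form is used for [j <= m - k], the
    second for the remaining [floor (k / 2)] pairs.  When [k] is odd the range
    has a fixed point [j = (n - k + 1) / 2]; there [j + k = n + 1 - j], so that
    the unpaired summand is [delta_j]. *)

Lemma sum_nat_fold (V : nmodType) (f : nat -> V) (N s : nat) :
  (s.*2 <= N)%N ->
  \sum_(1 <= j < N.+1) f j =
    \sum_(1 <= j < s.+1) (f j + f (N + 1 - j)%N)
    + \sum_(s.+1 <= j < (N - s).+1) f j.
Proof.
move=> le_sN.
rewrite (big_cat_nat (n := s.+1)) /=; [|lia|lia].
rewrite (big_cat_nat (n := (N - s).+1) (m := s.+1)) /=; [|lia|lia].
have -> : \sum_((N - s).+1 <= j < N.+1) f j
          = \sum_(1 <= j < s.+1) f (N + 1 - j)%N.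
  rewrite -add1n big_addn big_nat_rev /=.
  have -> : (N.+1 - (N - s) = s.+1)%N by lia.
  by apply: eq_big_nat => j hj; congr f; lia.
by rewrite big_split /= -addrA [X in _ + X = _]addrC addrA.
Qed.

Lemma term_sqr (n : nat) (a : n.-tuple int) (j : nat) :
  binary_seq a -> (1 <= j <= n)%N -> term a j * term a j = 1.
Proof.
move=> ha hj; rewrite /term.
have lt_jn : (j.-1 < n)%N by lia.
have := ha (Ordinal lt_jn); rewrite (tnth_nth 0) /=.
by case=> ->.
Qed.

Section MirrorPairs.

Variables (n k : nat) (a : n.-tuple int).
Hypothesis ha : binary_seq a.

Let mirror_summand (j : nat) : int :=
  term a (n - k + 1 - j)%N * term a (n - k + 1 - j + k)%N.

Lemma mirror_pair_shift (j : nat) :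
  (1 <= j <= n - k)%N ->
  term a j * term a (j + k)%N + mirror_summand j =
    term a j * term a (j + k)%N * (1 + delta a j * delta a (j + k)%N).
Proof.
move=> hj; rewrite /mirror_summand /delta.
have -> : (n - k + 1 - j = n + 1 - (j + k))%N by lia.
have -> : (n + 1 - (j + k) + k = n + 1 - j)%N by lia.
have sq_j : term a j * term a j = 1 by apply: term_sqr => //; lia.
have sq_jk : term a (j + k)%N * term a (j + k)%N = 1.
  by apply: term_sqr => //; lia.
transitivity (term a j * term a (j + k)%N
  + (term a j * term a j) * (term a (j + k)%N * term a (j + k)%N)
    * (term a (n + 1 - (j + k))%N * term a (n + 1 - j)%N)); last by ring.
by rewrite sq_j sq_jk !mul1r.
Qed.

Lemma mirror_pair_reflect (j : nat) :
  (1 <= j <= n - k)%N ->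
  term a j * term a (j + k)%N + mirror_summand j =
    term a j * term a (n - k + 1 - j)%N
    * (delta a j + delta a (n - k + 1 - j)%N).
Proof.
move=> hj; rewrite /mirror_summand /delta.
have -> : (n + 1 - (n - k + 1 - j) = j + k)%N by lia.
have -> : (n - k + 1 - j + k = n + 1 - j)%N by lia.
have sq_j : term a j * term a j = 1 by apply: term_sqr => //; lia.
have sq_q : term a (n - k + 1 - j)%N * term a (n - k + 1 - j)%N = 1.
  by apply: term_sqr => //; lia.
set q := (n - k + 1 - j)%N in sq_q *.
transitivity ((term a q * term a q) * (term a j * term a (j + k)%N)
  + (term a j * term a j) * (term a q * term a (n + 1 - j)%N)); last by ring.
by rewrite sq_j sq_q !mul1r.
Qed.

End MirrorPairs.

(** Both parities at once: the last sum is the unpaired middle of the range,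
    empty when [h = k / 2] and a single summand when [h = (k - 1) / 2]. *)
Lemma autocorr_fold (m k h : nat) (a : (2 * m).-tuple int) :
  binary_seq a -> (k <= m)%N -> (h.*2 <= k)%N ->
  autocorr a k =
    \sum_(1 <= j < (m - k).+1)
        term a j * term a (j + k)%N * (1 + delta a j * delta a (j + k)%N)
    + \sum_(1 <= j < h.+1)
        term a (j + m - k)%N * term a (m + 1 - j)%N
        * (delta a (j + m - k)%N + delta a (m + 1 - j)%N)
    + \sum_((m - k + h).+1 <= j < (m - h).+1) term a j * term a (j + k)%N.
Proof.
move=> ha le_km le_hk.
rewrite /autocorr (@sum_nat_fold _ _ _ (m - k + h)); last by lia.
have -> : (2 * m - k - (m - k + h) = m - h)%N by lia.
congr (_ + _); rewrite (big_cat_nat (n := (m - k).+1)) /=; [|lia|lia].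
congr (_ + _).
  by apply: eq_big_nat => j hj; apply: mirror_pair_shift => //; lia.
rewrite -add1n big_addn.
have -> : ((m - k + h).+1 - (m - k) = h.+1)%N by lia.
apply: eq_big_nat => j hj.
rewrite mirror_pair_reflect //; last by lia.
have -> : (2 * m - k + 1 - (j + (m - k)) = m + 1 - j)%N by lia.
by have -> : (j + (m - k) = j + m - k)%N by lia.
Qed.

Theorem lemma6 (n m k : nat) (a : n.-tuple int) (hn : (1 < n)%N)
    (hnm : n = (2 * m)%N) (ha : binary_seq a) (hk : (1 <= k < m)%N) :
  (~~ odd k ->
   autocorr a k =
     \sum_(1 <= j < (m - k).+1)
        term a j * term a (j + k)%N * (1 + delta a j * delta a (j + k)%N)
   + \sum_(1 <= j < (k %/ 2).+1)
        term a (j + m - k)%N * term a (m + 1 - j)%N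
        * (delta a (j + m - k)%N + delta a (m + 1 - j)%N))
  /\
  (odd k ->
   autocorr a k =
     delta a ((n - k + 1) %/ 2)%N
   + \sum_(1 <= j < (m - k).+1)
        term a j * term a (j + k)%N * (1 + delta a j * delta a (j + k)%N)
   + \sum_(1 <= j < ((k - 1) %/ 2).+1)
        term a (j + m - k)%N * term a (m + 1 - j)%N
        * (delta a (j + m - k)%N + delta a (m + 1 - j)%N)).
Proof.
subst n; split=> parity_k.
  rewrite (@autocorr_fold m k (k %/ 2)%N) //; [|lia|lia].
  by rewrite [X in _ + _ + X]big_geq ?addr0 //; lia.
rewrite (@autocorr_fold m k ((k - 1) %/ 2)%N) //; [|lia|lia].
have -> : ((m - (k - 1) %/ 2).+1 = (m - k + (k - 1) %/ 2).+2)%N by lia.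
rewrite big_nat1 -[RHS]addrA [RHS]addrC /delta.
have -> : ((2 * m - k + 1) %/ 2 = (m - k + (k - 1) %/ 2).+1)%N by lia.
congr (_ + _ * term a _); lia.
Qed.
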